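(* Let $\mu$ be a $d$-regular measure on $H$. There exists a constant $C_0=C_0(d,C_\mu)\ge 1$ such that $$\int_{U_\lambda(B(x,t))}c_d^2(X)\,\mathrm d\mu^{d+2}(X)\le \frac{C_0}{\lambda^{d(d+1)+4}}\cdot\beta_2^2(x,t)\cdot\mu(B(x,t))$$ for all $\lambda>0$, all $x\in\operatorname{supp}(\mu)$, and all $t\in\mathbb R$ with $0<t\le\operatorname{diam}(\operatorname{supp}(\mu))$.
   Context: $H$ is a real separable Hilbert space (possibly infinite dimensional) and $d\in\mathbb N$ with $d<\dim(H)$. $B(x,r)$ denotes the closed ball. A $d$-regular measure $\mu$ on $H$ is a locally finite Borel measure for which there is $C\ge1$ with $C^{-1}r^d\le\mu(B(x,r))\le Cr^d$ for all $x\in\operatorname{supp}(\mu)$ and $0<r\le\operatorname{diam}(\operatorname{supp}(\mu))$; $C_\mu$ is the smallest such $C$. The notation $C_0=C_0(d,C_\mu)$ means that the constant depends only on $d$ and $C_\mu$ (and on no other parameter of $\mu$ or $H$). $\mu^{d+2}$ is the product measure on $H^{d+2}$. For $v_1,\dots,v_{d+2}\in H$ pairwise distinct, $\mathrm{Vol}_{d+1}(v_1,\dots,v_{d+2})$ is the $(d+1)$-dimensional volume of the parallelotope spanned by $v_2-v_1,\dots,v_{d+2}-v_1$, $\operatorname{diam}(v_1,\dots,v_{d+2})$ is the diameter of the set $\{v_1,\dots,v_{d+2}\}$, and $$c_d^2(v_1,\dots,v_{d+2})=\frac1{d+2}\cdot\frac{\mathrm{Vol}_{d+1}^2(v_1,\dots,v_{d+2})}{\operatorname{diam}(v_1,\dots,v_{d+2})^{d(d+1)}}\sum_{i=1}^{d+2}\frac1{\prod_{j\ne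 i}\|v_j-v_i\|^2}.$$ For a ball $B=B(x,t)$ with $x\in\operatorname{supp}(\mu)$ and $0<t\le\operatorname{diam}(\operatorname{supp}(\mu))$, $$\beta_2^2(x,t)=\beta_2^2(B)=\inf_{L}\int_B\left(\frac{\operatorname{dist}(y,L)}{\operatorname{diam}(B)}\right)^2\frac{\mathrm d\mu(y)}{\mu(B)},$$ where $L$ ranges over all $d$-planes ($d$-dimensional affine subspaces) of $H$. For $\lambda>0$, $$U_\lambda(B(x,t))=\Big\{(v_1,\dots,v_{d+2})\in B(x,t)^{d+2}:\min_{1\le i<j\le d+2}\|v_i-v_j\|\ge\lambda t\Big\}.$$ *)

(* Defs.v *)
From HB Require Import structures.
From mathcomp Require Import all_boot all_order all_algebra.
From mathcomp Require Import all_classical all_reals all_analysis.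

Set Implicit Arguments.
Unset Strict Implicit.
Unset Printing Implicit Defensive.
Import Order.TTheory GRing.Theory Num.Theory.
Import numFieldTopology.Exports numFieldNormedType.Exports.

Local Open Scope classical_set_scope.
Local Open Scope ring_scope.

Notation borel H := (g_sigma_algebraType (@open H)).

Section LinearAlgebra.
Context {R : realType}.

Definition linearly_independent {V : lmodType R} {k : nat} (w : 'I_k -> V) :=
  forall a : 'I_k -> R, \sum_i a i *: w i = 0 -> forall i, a i = 0.

(* [k < dim V], with [V] possibly of infinite dimension *)
Definition dim_gt (k : nat) (V : lmodType R) :=
  exists w : 'I_k.+1 -> V, linearly_independent w.

Definition is_plane (k : nat) {V : lmodType R} (L : set V) :=
  exists (p : V) (w : 'I_k -> V), linearly_independent w /\
    L = [set y | exists a : 'I_k -> R, y = p + \sum_i a i *: w i].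

End LinearAlgebra.

Section Metric.
Context {R : realType} {H : normedModType R}.

Definition separable := exists2 D : set H, countable D & dense D.

Definition ediam (A : set H) : \bar R :=
  ereal_sup [set `|p.1 - p.2|%:E | p in A `*` A].

Definition diam (A : set H) : R := fine (ediam A).

Definition dist (y : H) (L : set H) : R := inf [set `|y - z| | z in L].

End Metric.
Arguments separable {R} H.

Section Curvature.
Context {R : realType} {H : completeNormedModType R} (ip : {dot H for idfun}).

(* the inner product induces the norm of the complete normed space [H] *)
Definition is_hilbert := forall x : H, `|x| ^+ 2 = ip x x.

(* k-dimensional volume of the parallelotope spanned by [w], as the square
   root of the Gram determinant *)
Definition parallelotope_volume (k : nat) (w : 'I_k -> H) : R :=
  Num.sqrt (\det (\matrix_(i < k, j < k) ip (w i) (w j))).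

(* Vol_{d+1}(v_1, ..., v_{d+2}) *)
Definition Vol (d : nat) (v : d.+2.-tuple H) : R :=
  parallelotope_volume
    (fun i : 'I_d.+1 => tnth v (lift ord0 i) - tnth v ord0).

Definition curvature_sq (d : nat) (v : d.+2.-tuple H) : R :=
  d.+2%:R^-1
  * (Vol v ^+ 2 / diam (range (tnth v)) ^+ (d * d.+1))
  * \sum_(i < d.+2) (\prod_(j < d.+2 | j != i) `|tnth v j - tnth v i| ^+ 2)^-1.

End Curvature.

Section PowerMeasure.
Context {dd : measure_display} {T : measurableType dd} {R : realType}.

(* the product measure mu^n on [n.-tuple T] *)
Fixpoint power_measure (mu : set T -> \bar R) (n : nat) :
    set (n.-tuple T) -> \bar R :=
  match n with
  | 0 => \d_([tuple] : 0.-tuple T)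
  | m.+1 => fun A => (mu \x @power_measure mu m)%E
      ((fun p : T * m.-tuple T => [the m.+1.-tuple T of p.1 :: p.2]) @^-1` A)
  end.

End PowerMeasure.
Arguments power_measure {dd T R} mu n A.

Lemma power_measure_box (dd : measure_display) (T : measurableType dd)
    (R : realType) (mu : {measure set T -> \bar R}) n (A : 'I_n -> set T) :
  (forall i, measurable (A i)) ->
  power_measure mu n [set v | forall i, A i (tnth v i)] =
  (\prod_(i < n) mu (A i))%E.
Proof.
elim: n A => [|n IH] A mA /=.
  by rewrite big_ord0 diracE mem_set//= => i; case: i.
pose A' i := A (lift ord0 i).
have mA' i : measurable (A' i) by exact: mA.
have n0 : power_measure mu n set0 = 0%E.
  case: n A mA A' mA' IH => [|n] A mA A' mA' IH; first by rewrite /= dirac0.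
  transitivity (\prod_(i < n.+1) mu (@set0 T))%E.
    rewrite -(IH (fun=> set0) (fun=> measurable0)).
    by congr (power_measure mu n.+1 _); apply/seteqP; split => // v /(_ ord0).
  by rewrite big_ord_recl measure0 mul0e.
rewrite big_ord_recl -(IH A')// /product_measure1.
set c := power_measure mu n _.
have c0 : (0 <= c)%E by rewrite /c IH//; apply: prode_ge0.
transitivity (\int[mu]_(x in A ord0) c)%E; last by rewrite integral_cst// muleC.
rewrite [RHS]integral_mkcond; apply: eq_integral => x _ /=.
rewrite patchE; case: ifPn => xA.
  congr (power_measure mu n _); apply/seteqP.
  split => v /=; rewrite /xsection /= inE /=.
    by move=> h i; have := h (lift ord0 i); rewrite tnthS.
  move=> h i; case: (unliftP ord0 i) => [j ->|->].
    by rewrite tnthS; exact: h.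
  by rewrite tnth0; exact: set_mem.
rewrite -[RHS]n0; congr (power_measure mu n _); apply/seteqP.
split => v //=; rewrite /xsection /= inE /= => /(_ ord0); rewrite tnth0 => h.
by move: xA; rewrite mem_set.
Qed.

Section Regular.
Context {R : realType} {H : completeNormedModType R}.
Implicit Type mu : {measure set (borel H) -> \bar R}.

Definition locally_finite mu :=
  forall x : H, exists U : set H, [/\ open U, U x & (mu U < +oo)%E].

Definition supp mu : set H :=
  [set x | forall U : set H, open U -> U x -> (0 < mu U)%E].

Definition regularity_bounds (d : nat) mu : set R :=
  [set C | 1 <= C /\ forall (x : H) (r : R),
     supp mu x -> 0 < r -> (r%:E <= ediam (supp mu))%E ->
     ((C^-1 * r ^+ d)%:E <= mu (closed_ball x r) <= (C * r ^+ d)%:E)%E].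

Definition regular (d : nat) mu :=
  locally_finite mu /\ regularity_bounds d mu !=set0.

(* C_mu; the infimum is attained whenever [mu] is d-regular *)
Definition regularity_constant (d : nat) mu : R := inf (regularity_bounds d mu).

Definition beta2_sq (d : nat) mu (x : H) (t : R) : \bar R :=
  let B := closed_ball x t in
  ereal_inf [set (\int[mu]_(y in B) ((dist y L / diam B) ^+ 2)%:E) / mu B
            | L in is_plane d]%E.

Definition separated_simplices (d : nat) (lambda : R) (x : H) (t : R) :
    set (d.+2.-tuple H) :=
  [set v | (forall i, closed_ball x t (tnth v i)) /\
           (forall i j : 'I_d.+2, (i < j)%N ->
              lambda * t <= `|tnth v i - tnth v j|)].

End Regular.
Arguments separated_simplices {R H} d lambda x t.

(* Main.v *)
From HB Require Import structures.
Require Import Defs.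
From mathcomp Require Import all_boot all_order all_algebra fingroup perm.
From mathcomp Require Import all_classical all_reals all_analysis.
From mathcomp Require Import measurable_realfun.
From mathcomp Require Import ring lra.

Set Implicit Arguments.
Unset Strict Implicit.
Unset Printing Implicit Defensive.
Import Order.TTheory GRing.Theory Num.Theory.
Import numFieldNormedType.Exports.
Local Open Scope classical_set_scope.
Local Open Scope ring_scope.

(** The curvature is bounded pointwise, then integrated one coordinate at a time.

    Fix a d-plane L. The squared volume of the parallelotope spanned by the
    edges v_j - v_i at the vertex v_i is their Gram determinant, which does not
    depend on i. Hence, after bringing the volume into the sum that defines
    c_d^2, the i-th summand is the Gram determinant of the d+1 unit vectors
    u_j = (v_j - v_i) / |v_j - v_i|. This normalisation is what gives the power
    of lambda: bounding the volume and the product of the edge lengths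
    separately would cost lambda^(2(d+1)) instead of lambda^2.

    If all the distances between vertices are at least rho, then u_j lies within
    (dist(v_j, L) + dist(v_i, L)) / rho of the direction space of L. That space
    has dimension d, so some nontrivial combination of the d+1 approximants
    vanishes. Normalised so that its largest coefficient is 1, the same
    combination of the u_j is a short vector which can replace one of them
    without changing the Gram determinant ([gram_det_near_flat]). The Leibniz
    formula and Cauchy-Schwarz then bound the determinant, up to a factorial, by
    the squared length of that short vector. Since the diameter of the vertices
    is at least rho as well, this gives, with rho = lambda t
    ([curvature_sq_le]),
      c_d^2(v) <= K_d (lambda t)^-(d(d+1)+2) sum_j dist(v_j, L)^2.

    The right-hand side is a sum of functions of a single vertex, and projecting
    the restriction of mu^(d+2) to B^(d+2) to one factor gives mu(B)^(d+1) times
    mu restricted to B ([integral_tnth_box]). Therefore the integral is at most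
    K_d (d+2) (lambda t)^-(d(d+1)+2) mu(B)^(d+1) times the integral over B of
    dist(y, L)^2. By regularity mu(B)^(d+1) <= C_mu^(d+1) t^(d(d+1)), and
    diam(B) <= 2t, so all the powers of t cancel. On a nonempty U_lambda one has
    lambda <= 2, whence lambda^-2 <= 4 lambda^-4. Taking the infimum over L
    yields beta_2^2. *)

(** * Gram determinants *)

Section Gram.
Context {R : realType} {H : completeNormedModType R} (ip : {dot H for idfun}).
Hypothesis ipE : is_hilbert ip.

Definition gram_det n (w : 'I_n -> H) : R :=
  \det (\matrix_(i < n, j < n) ip (w i) (w j)).

Lemma ipC u v : ip u v = ip v u.
Proof. by rewrite hermC /= expr0 mul1r. Qed.

Lemma ipZl a u v : ip (a *: u) v = a * ip u v.
Proof. exact: linearZl_LR. Qed.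

Lemma ipZr a u v : ip u (a *: v) = a * ip u v.
Proof. by rewrite ipC ipZl ipC. Qed.

Lemma cauchy_schwarz u v : `|ip u v| <= `|u| * `|v|.
Proof.
have [->|v0] := eqVneq v 0; first by rewrite linear0r normr0 mulr_ge0.
rewrite -ler_sqr ?nnegrE ?mulr_ge0// exprMn !ipE real_normK ?num_real//.
have vv : 0 < ip v v by rewrite -ipE exprn_gt0// normr_gt0.
rewrite -subr_ge0 -(pmulr_rge0 _ vv).
have -> : ip v v * (ip u u * ip v v - ip u v ^+ 2)
    = ip (ip v v *: u - ip u v *: v) (ip v v *: u - ip u v *: v).
  by rewrite linearBl /= !linearBr /= !ipZl !ipZr (ipC v u); ring.
by rewrite -ipE sqr_ge0.
Qed.

Lemma gram_det_comb n (A : 'M[R]_n) (w : 'I_n -> H) :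
  gram_det (fun i => \sum_j A i j *: w j) = \det A ^+ 2 * gram_det w.
Proof.
rewrite /gram_det; set G := \matrix_(i, j) ip (w i) (w j).
have -> : \matrix_(i, j) ip (\sum_k A i k *: w k) (\sum_k A j k *: w k)
    = A *m G *m A^T.
  apply/matrixP => i j; rewrite !mxE linear_sumr /=; apply: eq_bigr => k _.
  rewrite ipZr mxE [RHS]mulrC mxE linear_sumlz /=; congr (_ * _).
  by apply: eq_bigr => l _; rewrite ipZl mxE.
by rewrite !det_mulmx det_tr mulrAC expr2.
Qed.

(** In the Leibniz formula, each permutation contributes a product of inner
    products in which every vector occurs twice, once as a row and once as a
    column. *)
Lemma gram_det_le n (w : 'I_n -> H) :
  gram_det w <= n`!%:R * \prod_i `|w i| ^+ 2.
Proof.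
apply: (le_trans (ler_norm _)); apply: (le_trans (ler_norm_sum _ _ _)).
rewrite -card_Sn -sum1_card natr_sum mulr_suml.
apply: ler_sum => s _; rewrite mul1r normrM normrX normrN1 expr1n mul1r.
rewrite normr_prod.
have -> : \prod_i `|w i| ^+ 2 = \prod_i (`|w i| * `|w (s i)|).
  have ws : \prod_i `|w (s i)| = \prod_i `|w i| by rewrite [RHS](reindex_perm s).
  by rewrite [RHS]big_split /= ws -big_split.
by apply: ler_prod => i _; rewrite normr_ge0 mxE cauchy_schwarz.
Qed.

(** The normalisation by the largest coefficient keeps the combination of the
    errors below the sum of their norms in [gram_det_near_flat]. *)
Lemma dependent_family d (l : 'I_d.+1 -> H) (e : 'I_d -> H)
    (a : 'I_d.+1 -> 'I_d -> R) : (forall j, l j = \sum_k a j k *: e k) ->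
  exists (c : 'I_d.+1 -> R) (p : 'I_d.+1),
    [/\ c p = 1, forall j, `|c j| <= 1 & \sum_j c j *: l j = 0].
Proof.
move=> lE; pose M := \matrix_(j < d.+1, k < d) a j k.
have /rowV0Pn[b bM b0] : kermx M != 0.
  by rewrite -mxrank_eq0 mxrank_ker subn_eq0 -ltnNge ltnS rank_leq_col.
have [p _ pmax'] := @arg_maxP _ _ _ ord0 xpredT (fun j => `|b 0 j|) isT.
have pmax j : `|b 0 j| <= `|b 0 p| by exact: pmax'.
have bp0 : b 0 p != 0.
  apply: contra_neq b0 => bp; apply/rowP => j; rewrite mxE; apply/eqP.
  by rewrite -normr_le0 (le_trans (pmax j))// bp normr0.
exists (fun j => b 0 j / b 0 p), p; split => [|j|].
- by rewrite divff.
- by rewrite normrM normfV ler_pdivrMr ?normr_gt0// mul1r pmax.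
- under eq_bigr => j _ do rewrite lE scaler_sumr.
  rewrite exchange_big big1// => k _.
  under eq_bigr => j _ do rewrite scalerA mulrAC.
  rewrite -scaler_suml -mulr_suml.
  move/sub_kermxP/rowP/(_ k): bM; rewrite !mxE => bM.
  rewrite (_ : \sum_i _ = 0) ?mul0r ?scale0r// -[RHS]bM.
  by apply: eq_bigr => j _; rewrite !mxE.
Qed.

(** The [l j] are d+1 vectors in the span of d vectors, hence dependent; the
    relation between them, applied to the [u j], leaves only the errors
    [u j - l j]. Only one of the [u j] may be replaced by that combination, but
    it counts twice in the Gram determinant, whence the square. *)
Lemma gram_det_near_flat d (u l : 'I_d.+1 -> H) (e : 'I_d -> H)
    (a : 'I_d.+1 -> 'I_d -> R) :
  (forall j, `|u j| <= 1) -> (forall j, l j = \sum_k a j k *: e k) ->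
  gram_det u <= d.+1`!%:R * (\sum_j `|u j - l j|) ^+ 2.
Proof.
move=> u1 /dependent_family[c [p [cp c1 cl]]].
(* [A] replaces the vector of index [p] by the combination [c]. *)
pose A : 'M[R]_d.+1 := \matrix_(i, j) (if i == p then c j else (i == j)%:R).
have Au i : \sum_j A i j *: u j = if i == p then \sum_j c j *: u j else u i.
  case: ifPn => ip'.
    by apply: eq_bigr => j _; rewrite mxE ip'.
  rewrite (bigD1 i)//= mxE (negbTE ip') eqxx scale1r big1 ?addr0// => j ji.
  by rewrite mxE (negbTE ip') eq_sym (negbTE ji) scale0r.
have detA : \det A = 1.
  rewrite (expand_det_col _ p) (bigD1 p)//= big1 ?addr0; last first.
    by move=> i ip'; rewrite mxE (negbTE ip') mul0r.
  rewrite mxE eqxx cp mul1r /cofactor -signr_odd oddD addbb expr0 mul1r.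
  rewrite [X in \det X](_ : _ = 1%:M) ?det1//; apply/matrixP => i j.
  by rewrite !mxE eq_sym (negbTE (neq_lift _ _)) (inj_eq lift_inj).
have <- : gram_det (fun i => if i == p then \sum_j c j *: u j else u i)
    = gram_det u.
  rewrite -[RHS]mul1r -[X in X * _](expr1n _ 2) -{1}detA -gram_det_comb.
  by congr gram_det; apply/funext => i; rewrite Au.
apply: le_trans (gram_det_le _) _; rewrite ler_wpM2l// (bigD1 p)//= eqxx.
rewrite -[leRHS]mulr1 ler_pM//.
- by rewrite prodr_ge0.
- rewrite ler_pXn2r ?nnegrE ?sumr_ge0//.
  have -> : \sum_j c j *: u j = \sum_j c j *: (u j - l j).
    by under [RHS]eq_bigr do rewrite scalerBr; rewrite sumrB cl subr0.
  apply: le_trans (ler_norm_sum _ _ _) _; apply: ler_sum => j _.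
  by rewrite normrZ ler_piMl.
- apply: numdomain.Num.Theory.prodr_ile1 => i /negbTE ->; rewrite exprn_ge0//=.
  by rewrite exprn_ile1.
Qed.

End Gram.

(** * Diameters of bounded sets *)

Section Diameter.
Context {R : realType} {H : normedModType R}.
Variables (A : set H) (x : H) (t : R).
Hypothesis At : forall y, A y -> `|x - y| <= t.

Lemma ediam_le : (ediam A <= (t + t)%:E)%E.
Proof.
apply: ge_ereal_sup => _ [[y z] /= [Ay Az] <-]; rewrite lee_fin.
rewrite -(subrK x y) -addrA (le_trans (ler_normD _ _))//.
by rewrite lerD ?At// distrC At.
Qed.

Variables p q : H.
Hypotheses (Ap : A p) (Aq : A q).

Let ediam_ge : (`|p - q|%:E <= ediam A)%E.
Proof. by apply: ereal_sup_ubound; exists (p, q). Qed.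

Let ediam_fin : ediam A \is a fin_num.
Proof.
rewrite fin_numE; apply/andP; split.
  by apply: contraTneq ediam_ge => ->.
by apply: contraTneq ediam_le => ->.
Qed.

Lemma le_diam : `|p - q| <= diam A.
Proof. by rewrite -lee_fin fineK. Qed.

Lemma diam_le : diam A <= t + t.
Proof. by rewrite -lee_fin fineK// ediam_le. Qed.

End Diameter.

(** * The pointwise bound on the curvature *)

Section Vertices.
Context {R : realType} {H : completeNormedModType R} (ip : {dot H for idfun}).
Hypothesis ipE : is_hilbert ip.
Variable d : nat.
Implicit Types v : d.+2.-tuple H.

(** The edges at the vertex [i], indexed by ['I_d.+1] for every [i]: the
    transposition puts the edge towards the vertex [0] at the index that would
    otherwise designate the vertex [i] itself, which makes the change of base
    vertex an involution. *)
Definition edges v (i : 'I_d.+2) (k : 'I_d.+1) : H :=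
  tnth v (tperm ord0 i (lift ord0 k)) - tnth v i.

(** Passing from the edges at [0] to those at [i = lift ord0 p] subtracts the
    edge [p] from all the others and negates it. This linear map is an
    involution, so its determinant squares to 1. *)
Lemma gram_det_edges v i : gram_det ip (edges v i) = gram_det ip (edges v ord0).
Proof.
have e0 k : edges v ord0 k = tnth v (lift ord0 k) - tnth v ord0.
  by rewrite /edges tperm1 perm1.
case: (unliftP ord0 i) => [p ->|->//].
(* [A] is a reflection [1 - c *m f], where [f = delta_mx 0 p] has [f *m c = 2]. *)
pose c : 'cV[R]_d.+1 := \col_k (1 + (k == p)%:R).
pose A : 'M[R]_d.+1 := 1%:M - c *m delta_mx 0 p.
have A2 : \det A ^+ 2 = 1.
  rewrite expr2 -det_mulmx -[RHS](det1 _ d.+1); congr (\det _).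
  have dc : delta_mx 0 p *m c = 2%:M.
    apply/matrixP => x y; rewrite !ord1 -rowE !mxE eqxx/=.
    by rewrite mulr1n.
  rewrite /A mulmxBr mulmx1 mulmxBl mul1mx mulmxA -(mulmxA c) dc.
  rewrite mul_mx_scalar -scalemxAl scaler_nat.
  by rewrite mulr2n; move: (c *m _) => B; rewrite opprB addrK subrK.
rewrite -[RHS]mul1r -A2 -gram_det_comb; congr gram_det; apply/funext => k.
have -> : \sum_j A k j *: edges v ord0 j
    = edges v ord0 k - (1 + (k == p)%:R) *: edges v ord0 p.
  have AE j : A k j = (k == j)%:R - (1 + (k == p)%:R) * (j == p)%:R.
    by rewrite !mxE big_ord1 !mxE eqxx.
  under eq_bigr do rewrite AE scalerBl -scalerA.
  rewrite sumrB -scaler_sumr; congr (_ - _ *: _).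
    rewrite (bigD1 k)//= eqxx scale1r big1 ?addr0// => j jk.
    by rewrite eq_sym (negbTE jk) scale0r.
  rewrite (bigD1 p)//= eqxx scale1r big1 ?addr0// => j jp.
  by rewrite (negbTE jp) scale0r.
rewrite !e0 /edges; case: eqVneq => [->|kp].
  by rewrite tpermR scalerDl !scale1r opprD addrA subrr sub0r opprB.
rewrite addr0 scale1r tpermD ?(inj_eq lift_inj) 1?eq_sym//.
by rewrite opprB addrA subrK.
Qed.

Lemma prod_edges v i :
  \prod_(j < d.+2 | j != i) `|tnth v j - tnth v i| ^+ 2
    = \prod_(k < d.+1) `|edges v i k| ^+ 2.
Proof.
rewrite (reindex_perm (tperm ord0 i)) /= big_mkcond big_ord_recl /=.
rewrite tpermL eqxx mul1r; apply: eq_bigr => k _.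
by rewrite -[X in _ != X](tpermL ord0 i) (inj_eq perm_inj).
Qed.

Lemma gram_det_scale n (a : 'I_n -> R) (w : 'I_n -> H) :
  gram_det ip (fun k => a k *: w k) = (\prod_k a k) ^+ 2 * gram_det ip w.
Proof.
have -> : \prod_k a k = \det (diag_mx (\row_k a k)).
  by rewrite det_diag; apply: eq_bigr => k _; rewrite mxE.
rewrite -gram_det_comb; congr gram_det; apply/funext => k.
rewrite (bigD1 k)//= !mxE eqxx mulr1n big1 ?addr0// => j jk.
by rewrite !mxE eq_sym (negbTE jk) mulr0n scale0r.
Qed.

(** The direction space of the plane contains the vectors
    [(q j - q i) / |v_j - v_i|]; [gram_det_near_flat] is applied to them and to
    the normalised edges. *)
Lemma gram_det_edges_plane v i (q : 'I_d.+2 -> H) (p : H) (e : 'I_d -> H)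
    (a : 'I_d.+2 -> 'I_d -> R) (rho : R) : 0 < rho ->
  (forall j, j != i -> rho <= `|tnth v j - tnth v i|) ->
  (forall j, q j = p + \sum_k a j k *: e k) ->
  gram_det ip (edges v i) / \prod_k `|edges v i k| ^+ 2
  <= d.+1`!%:R * (d.+1%:R * (\sum_j `|tnth v j - q j|) / rho) ^+ 2.
Proof.
move=> rho0 sep qE; set S := \sum_j _.
pose tau k := tperm ord0 i (lift ord0 k).
have tau_neq k : tau k != i.
  by rewrite -[X in _ != X](tpermL ord0 i) (inj_eq perm_inj).
have rho_le k : rho <= `|edges v i k| by exact: sep (tau_neq k).
have r0 k : 0 < `|edges v i k| by exact: lt_le_trans (rho_le k).
pose u k := `|edges v i k|^-1 *: edges v i k.
pose l k := `|edges v i k|^-1 *: (q (tau k) - q i).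
have lE k : l k = \sum_k' (`|edges v i k|^-1 * (a (tau k) k' - a i k')) *: e k'.
  rewrite /l !qE opprD addrACA subrr add0r -sumrB scaler_sumr.
  by apply: eq_bigr => k' _; rewrite -scalerBl scalerA.
have u1 k : `|u k| <= 1.
  by rewrite normrZ normfV normr_id mulVf// gt_eqF.
have ul k : `|u k - l k| <= S / rho.
  rewrite -scalerBr normrZ normfV normr_id [leRHS]mulrC ler_pM ?invr_ge0//.
    by rewrite lef_pV2 ?posrE.
  have -> : edges v i k - (q (tau k) - q i)
      = (tnth v (tau k) - q (tau k)) - (tnth v i - q i).
    by rewrite /edges -/(tau k) !opprD !opprK addrACA.
  apply: le_trans (ler_normB _ _) _.
  rewrite /S (bigD1 (tau k))//= lerD2l (bigD1 i) 1?eq_sym//= lerDl.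
  by rewrite sumr_ge0.
apply: le_trans (_ : gram_det ip u <= _).
  by rewrite gram_det_scale mulrC prodfV exprVn prodrXl.
apply: le_trans (gram_det_near_flat ipE u1 lE) _.
rewrite ler_wpM2l// ler_pXn2r ?nnegrE ?sumr_ge0//; last first.
  by rewrite divr_ge0 ?mulr_ge0 ?sumr_ge0// ltW.
apply: le_trans (ler_sum _ (fun k _ => ul k)) _.
by rewrite sumr_const card_ord -mulrA mulr_natl.
Qed.

Lemma dist_ge0 (y : H) (L : set H) : L !=set0 -> 0 <= dist y L.
Proof.
move=> [z Lz]; apply: lb_le_inf; first by exists `|y - z|, z.
by move=> _ [w _ <-].
Qed.

Lemma plane_neq0 (L : set H) : is_plane d L -> L !=set0.
Proof. by move=> [p [e [_ ->]]]; exists (p + \sum_i 0 *: e i), (fun=> 0). Qed.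

Lemma dist_adherent (y : H) (L : set H) (eps : R) : L !=set0 -> 0 < eps ->
  exists2 z, L z & `|y - z| < dist y L + eps.
Proof.
move=> [z Lz] eps0; have := @inf_adherent _ [set `|y - z| | z in L] _ eps0.
case; first by split; [exists `|y - z|, z|exists 0 => _ [w _ <-]].
by move=> _ [w Lw <-] ?; exists w.
Qed.

(** The points of [L] chosen near the vertices only approach the distances to
    [L]. Comparing square roots makes the error linear in the approximation, so
    that it can be sent to 0. *)
Lemma gram_det_edges_dist v i (L : set H) (rho : R) : is_plane d L -> 0 < rho ->
  (forall j, j != i -> rho <= `|tnth v j - tnth v i|) ->
  gram_det ip (edges v i) / \prod_k `|edges v i k| ^+ 2
  <= d.+1`!%:R * (d.+1%:R * (\sum_j dist (tnth v j) L) / rho) ^+ 2.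
Proof.
move=> pL rho0 sep; have L0 := plane_neq0 pL.
have fact0 : 0 < d.+1`!%:R :> R by rewrite ltr0n fact_gt0.
rewrite -ler_pdivrMl//; set g := (X in X <= _).
have S0 : 0 <= d.+1%:R * (\sum_j dist (tnth v j) L) / rho.
  by rewrite divr_ge0 ?mulr_ge0 ?sumr_ge0// ?ltW// => j _; exact: dist_ge0.
have [g0|g0] := leP g 0; first by rewrite (le_trans g0)// exprn_ge0.
rewrite -(sqr_sqrtr (ltW g0)) ler_pXn2r ?nnegrE ?sqrtr_ge0//.
apply/ler_addgt0Pr => eps eps0.
(* The total error over the d+2 vertices is then exactly [eps]. *)
pose del := eps * rho / (d.+1%:R * d.+2%:R).
have del0 : 0 < del by rewrite divr_gt0 ?mulr_gt0.
have /choice[q qL] : forall j, exists z, L z /\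
    `|tnth v j - z| < dist (tnth v j) L + del.
  by move=> j; have [z ? ?] := dist_adherent (tnth v j) L0 del0; exists z.
have [p [e [_ LE]]] := pL.
have /choice[a aE] : forall j, exists a : 'I_d -> R,
    q j = p + \sum_k a k *: e k.
  by move=> j; have [] := qL j; rewrite LE.
have := gram_det_edges_plane rho0 sep aE.
rewrite -ler_pdivrMl// -/g => gle.
have q0 : 0 <= d.+1%:R * (\sum_j `|tnth v j - q j|) / rho.
  by rewrite divr_ge0 ?mulr_ge0 ?sumr_ge0// ltW.
apply: (@le_trans _ _ (d.+1%:R * (\sum_j `|tnth v j - q j|) / rho)).
  by rewrite -(ler_pXn2r (n := 2))// ?nnegrE ?sqrtr_ge0// sqr_sqrtr// ltW.
apply: (@le_trans _ _ (d.+1%:R * (\sum_j (dist (tnth v j) L + del)) / rho)).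
  rewrite ler_pM2r ?invr_gt0// ler_pM2l//.
  by apply: ler_sum => j _; exact/ltW/(qL j).2.
rewrite big_split/= sumr_const card_ord mulrDr mulrDl lerD2l -(mulr_natr del).
rewrite le_eqVlt; apply/orP; left; apply/eqP; rewrite /del.
by field; rewrite nat1r -natrD !pnatr_eq0 gt_eqF.
Qed.

Lemma sqr_sum_le n (D : 'I_n -> R) :
  (\sum_j D j) ^+ 2 <= n%:R * \sum_j D j ^+ 2.
Proof.
rewrite expr2 big_distrlr /=.
apply: (@le_trans _ _ (\sum_(i < n) \sum_(j < n) (D i ^+ 2 / 2 + D j ^+ 2 / 2))).
  apply: ler_sum => i _; apply: ler_sum => j _.
  by have := sqr_ge0 (D i - D j); rewrite sqrrB; lra.
have E i : \sum_(j < n) (D i ^+ 2 / 2 + D j ^+ 2 / 2)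
    = (D i ^+ 2 / 2) *+ n + (\sum_j D j ^+ 2) / 2.
  by rewrite big_split /= sumr_const card_ord -mulr_suml.
rewrite (eq_bigr _ (fun i _ => E i)) big_split /= sumr_const card_ord.
rewrite sumrMnl -mulr_suml.
by rewrite -mulrnDl -splitr mulr_natl.
Qed.

Lemma curvature_sq_le v (L : set H) (x : H) (t rho : R) :
  is_plane d L -> 0 < rho ->
  (forall i, `|x - tnth v i| <= t) ->
  (forall i j : 'I_d.+2, (i < j)%N -> rho <= `|tnth v i - tnth v j|) ->
  curvature_sq ip v <= d.+1`!%:R * d.+1%:R ^+ 2 * d.+2%:R
    / rho ^+ (d * d.+1 + 2) * \sum_j dist (tnth v j) L ^+ 2.
Proof.
move=> pL rho0 vB sep.
have sep' i j : j != i -> rho <= `|tnth v j - tnth v i|.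
  by rewrite neq_ltn => /orP[] /sep//; rewrite distrC.
set S2 := \sum_j _.
have S20 : 0 <= S2 by apply: sumr_ge0 => j _; exact: sqr_ge0.
set X := d.+1`!%:R * d.+1%:R ^+ 2 * d.+2%:R / rho ^+ 2 * S2.
have X0 : 0 <= X by rewrite !mulr_ge0 ?invr_ge0// ?exprn_ge0// ltW.
have VolE : Vol ip v ^+ 2 = Num.sqrt (gram_det ip (edges v ord0)) ^+ 2.
  congr (Num.sqrt _ ^+ 2); congr gram_det; apply/funext => k.
  by rewrite /edges tperm1 perm1.
(* A negative Gram determinant would have square root 0. *)
have term i : Vol ip v ^+ 2 *
    (\prod_(j < d.+2 | j != i) `|tnth v j - tnth v i| ^+ 2)^-1 <= X.
  rewrite VolE prod_edges; have [G0|G0] := leP (gram_det ip (edges v ord0)) 0.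
    by rewrite ler0_sqrtr// expr0n mul0r.
  rewrite (sqr_sqrtr (ltW G0)) -(gram_det_edges v i).
  apply: le_trans (gram_det_edges_dist pL rho0 (sep' i)) _.
  rewrite !exprMn exprVn mulrAC.
  have -> : X = d.+1`!%:R * (d.+1%:R ^+ 2 / rho ^+ 2 * (d.+2%:R * S2)).
    by rewrite /X; ring.
  rewrite ler_wpM2l// ler_wpM2l ?sqr_sum_le//.
  by rewrite divr_ge0 ?exprn_ge0// ltW.
have diam_ge : rho <= diam (range (tnth v)).
  apply: (le_trans (sep ord0 ord_max isT)); apply: (@le_diam _ _ _ x t).
  - by move=> _ [i _ <-]; exact: vB.
  - by exists ord0.
  - by exists ord_max.
have total : Vol ip v ^+ 2 *
    (\sum_(i < d.+2) (\prod_(j < d.+2 | j != i) `|tnth v j - tnth v i| ^+ 2)^-1)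
    <= d.+2%:R * X.
  rewrite mulr_sumr; apply: le_trans (ler_sum _ (fun i _ => term i)) _.
  by rewrite sumr_const card_ord mulr_natl.
have -> : d.+1`!%:R * d.+1%:R ^+ 2 * d.+2%:R / rho ^+ (d * d.+1 + 2) * S2
    = X / rho ^+ (d * d.+1).
  by rewrite /X exprD invfM; ring.
rewrite /curvature_sq -mulrA (mulrAC (Vol ip v ^+ 2)) mulrA.
have diamN : rho ^+ (d * d.+1) <= diam (range (tnth v)) ^+ (d * d.+1).
  by rewrite lerXn2r ?nnegrE// ltW// (lt_le_trans rho0).
have rhoN : 0 < rho ^+ (d * d.+1) by exact: exprn_gt0.
apply: (@le_trans _ _ (X / diam (range (tnth v)) ^+ (d * d.+1))).
  rewrite ler_pM2r ?invr_gt0 ?(lt_le_trans rhoN)//.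
  by rewrite ler_pdivrMl.
by rewrite ler_wpM2l// lef_pV2// posrE (lt_le_trans rhoN).
Qed.

End Vertices.
(** * Integration against the power measure *)

Section Measures.
Local Open Scope ereal_scope.
Context {R : realType}.

(** Both integrals are suprema over the simple functions below the integrand,
    extended by 0 outside of its domain, so a pointwise comparison is enough. It
    passes from the curvature on the separated simplices to a majorant on the
    whole box, which is measurable. *)
Lemma le_integral_majorant d (T : measurableType d)
    (m : {measure set T -> \bar R}) (D E : set T) (f g : T -> \bar R) :
  D `<=` E -> (forall x, D x -> 0 <= f x <= g x) -> (forall x, E x -> 0 <= g x) ->
  \int[m]_(x in D) f x <= \int[m]_(x in E) g x.
Proof.
move=> DE fg g0; rewrite !ge0_integralE//; last by move=> x /fg/andP[].
apply: le_ereal_sup => _ [h hf <-]; exists h => // x.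
apply: le_trans (hf x) _; rewrite !patchE; case: ifPn => [|xD].
  by rewrite inE => Dx; rewrite mem_set ?(andP (fg _ Dx)).2//; exact: DE.
by case: ifPn => //; rewrite inE => /g0.
Qed.

Lemma integral_mrestr d (T : measurableType d)
    (m : {measure set T -> \bar R}) (D : set T) (mD : measurable D)
    (f : T -> \bar R) : measurable_fun setT f -> (forall x, 0 <= f x) ->
  \int[mrestr m mD]_x f x = \int[m]_(x in D) f x.
Proof.
move=> mf f0; rewrite -(setUv D) ge0_integral_setU//=; last 3 first.
- exact: measurableC.
- by rewrite setUv.
- by rewrite disj_set2E setICr.
rewrite [X in _ + X](_ : _ = 0) ?adde0.
  by apply: eq_measure_integral => A mA AD; rewrite /= /mrestr setIidl.
rewrite -(@integral_measure_zero _ T R (~` D) f).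
apply: eq_measure_integral => A mA AD.
by rewrite /= /mrestr (_ : A `&` D = set0) ?measure0//; exact/disjoints_subset.
Qed.

Lemma measurable_box d (T : measurableType d) n (A : 'I_n -> set T) :
  (forall i, measurable (A i)) ->
  measurable [set v : n.-tuple T | forall i, A i (tnth v i)].
Proof.
move=> mA.
rewrite (_ : [set _ | _] =
    \bigcap_(i in [set: 'I_n]) ((@tnth _ T)^~ i @^-1` A i)).
  apply: fin_bigcap_measurable => // i _; rewrite -[X in measurable X]setTI.
  exact: measurable_tnth.
by apply/seteqP; split => v /= h i => [_|]; [exact: h|exact: (h i Logic.I)].
Qed.

Lemma sigma_finite_power_measure d (T : measurableType d)
    (mu : {measure set T -> \bar R}) n : sigma_finite setT mu ->
  sigma_finite setT (power_measure mu n).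
Proof.
move=> /sigma_finiteP[F [FT Fmono mF]].
exists (fun k => [set v : n.-tuple T | forall i, F k (tnth v i)]).
  apply/esym; rewrite -subTset => v _.
  have /choice[k kF] : forall i : 'I_n, exists k, F k (tnth v i).
    move=> i; have : [set: T] (tnth v i) by [].
    by rewrite FT => -[k _ ?]; exists k.
  exists (\max_(i < n) k i)%N => // i /=.
  have /subsetPset le_F : (F (k i) <= F (\max_(i < n) k i)%N)%O.
    exact/Fmono/leq_bigmax.
  exact: le_F.
move=> k; split.
  by apply: (@measurable_box _ _ _ (fun=> F k)) => i; exact: (mF k).1.
rewrite (@power_measure_box _ _ _ _ _ (fun=> F k)); last first.
  by move=> i; exact: (mF k).1.
have /fineK <- : mu (F k) \is a fin_num by rewrite ge0_fin_numE ?(mF k).2.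
by rewrite prodEFin ltry.
Qed.

(** Sigma-finiteness is what makes the measure of the sections of a measurable
    set a measurable function, hence the product countably additive. *)
Lemma power_measure_is_measure d (T : measurableType d)
    (mu : {measure set T -> \bar R}) n : sigma_finite setT mu ->
  exists m : {measure set (n.-tuple T) -> \bar R}, power_measure mu n = m.
Proof.
move=> smu; elim: n => [|n [m mE]]; first by exists (\d_([tuple] : 0.-tuple T)).
have sm : sigma_finite setT m by rewrite -mE; exact: sigma_finite_power_measure.
pose sfin := isSFinite.Build _ _ _ _ (sfinite_measure_sigma_finite sm).
pose sgfin := isSigmaFinite.Build _ _ _ _ sm.
pose m' := HB.pack_for (SigmaFiniteMeasure.type (n.-tuple T) R)
  (Measure.sort m) sfin sgfin.
pose cons_tuple (p : T * n.-tuple T) := [the n.+1.-tuple T of p.1 :: p.2].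
have mcons : measurable_fun setT cons_tuple by exact: measurable_cons.
exists (@measure_function_pushforward__canonical__measure_function_Measure
  _ _ _ _ _ (mu \x m') _ mcons).
by rewrite /= mE.
Qed.

(** The image under the [i]-th coordinate of the power measure restricted to the
    box is [b ^+ n] times the restriction of [mu] to [B], as the values on boxes
    show; the formula is then a change of variables. *)
Lemma integral_tnth_box d (T : measurableType d)
    (mu : {measure set T -> \bar R}) n (B : set T) (b : R) (f : T -> \bar R)
    (i : 'I_n.+1) : sigma_finite setT mu ->
  measurable B -> mu B = b%:E -> measurable_fun setT f -> (forall x, 0 <= f x) ->
  \int[power_measure mu n.+1]_(v in [set v | forall j, B (tnth v j)])
    f (tnth v i) = (b ^+ n)%:E * \int[mu]_(y in B) f y.
Proof.
move=> smu mB muB mf f0.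
have [m mE] := power_measure_is_measure n.+1 smu.
have mbox := @measurable_box _ T n.+1 (fun=> B) (fun=> mB).
have b0 : (0 <= b ^+ n)%R by rewrite exprn_ge0// -lee_fin -muB.
have mti := @measurable_tnth _ T n.+1 i.
rewrite mE -(integral_mrestr m mbox); last 2 first.
- exact: measurableT_comp.
- by [].
have := ge0_integral_pushforward mti (mrestr m mbox) measurableT mf.
rewrite preimage_setT => <-; last by move=> y _; exact: f0.
rewrite -(integral_mrestr mu mB)//.
rewrite -(ge0_integral_mscale _ measurableT (NngNum b0))//.
apply: eq_measure_integral => A mA _.
rewrite /= /pushforward /mscale /mrestr -mE.
pose C j := if j == i then A `&` B else B.
have mC j : measurable (C j).
  by rewrite /C; case: ifPn => // _; exact: measurableI.
rewrite (_ : _ `&` _ = [set v | forall j, C j (tnth v j)]).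
  rewrite power_measure_box// (bigD1 i)//= {1}/C eqxx muleC; congr (_ * _).
  rewrite (eq_bigr (fun=> b%:E)); last by move=> j /negbTE ji; rewrite /C ji.
  by rewrite prodEFin prodr_const cardC1 card_ord.
apply/seteqP; split => v /=.
  by move=> [Avi Bv] j; rewrite /C; case: eqP => [->|].
move=> Cv; split; first by have := Cv i; rewrite /C eqxx => -[].
by move=> j; have := Cv j; rewrite /C; case: ifP => // _ [].
Qed.

End Measures.

(** * Borel measures on a separable space *)

Section Borel.
Context {R : realType} {H : completeNormedModType R}.

Lemma open_borel (U : set H) : open U -> measurable (U : set (borel H)).
Proof. by move=> oU; exact: sub_gen_smallest. Qed.

Lemma closed_borel (A : set H) : closed A -> measurable (A : set (borel H)).
Proof. by move/closed_openC/open_borel/measurableC; rewrite setCK. Qed.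

Lemma continuous_borel (f : H -> R) : continuous f ->
  measurable_fun setT (f : borel H -> R).
Proof.
move=> /continuousP cf; apply: (measurability _ (RGenOpens.measurableE R)).
move=> _ [_ [a [b ->] <-]]; rewrite setTI; apply: open_borel.
exact/cf/interval_open.
Qed.

Lemma dist_lipschitz (L : set H) (y z : H) : L !=set0 ->
  `|dist y L - dist z L| <= `|y - z|.
Proof.
move=> L0; have main (a b : H) : dist a L <= `|a - b| + dist b L.
  apply/ler_addgt0Pr => e e0; have [w Lw bw] := dist_adherent b L0 e0.
  apply: (@le_trans _ _ `|a - w|).
    apply: ge_inf; last by exists w.
    by exists 0 => _ [? _ <-].
  rewrite -(subrK b a) -addrA (le_trans (ler_normD _ _))// subrK -addrA.
  by rewrite lerD2l ltW.
rewrite ler_norml; have := main y z; have := main z y.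
by rewrite (distrC z y) => h1 h2; apply/andP; split; lra.
Qed.

Lemma continuous_dist (L : set H) : L !=set0 -> continuous (fun y => dist y L).
Proof.
move=> L0 y; apply/cvgrPdist_lt => e e0; near=> z.
apply: le_lt_trans (dist_lipschitz _ _ L0) _.
by near: z; exact: cvgr_dist_lt.
Unshelve. all: by end_near. Qed.

(** The balls of finite measure with centre in a dense sequence and radius
    [1 / m.+1] cover the space. *)
Lemma sigma_finite_locally_finite (mu : {measure set (borel H) -> \bar R}) :
  separable H -> locally_finite mu -> sigma_finite setT mu.
Proof.
move=> [D cD dD] lf; have /pcard_surjP[g gD] := cD.
pose B n m : set (borel H) := ball (g n) (m.+1%:R^-1).
pose F k : set (borel H) := if unpickle k is Some (n, m) then
  (if (mu (B n m) < +oo)%E then B n m else set0) else set0.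
have mB n m : measurable (B n m) by apply: open_borel; exact: ball_open.
exists F; last first.
  move=> k; rewrite /F; case: unpickle => [[n m]|]; last by rewrite measure0.
  by case: ifPn => // _; rewrite measure0.
apply/esym; rewrite -subTset => y _.
have [U [oU Uy muU]] := lf y.
have /nbhs_ballP[e /= e0 yU] : nbhs y U by exact: open_nbhs_nbhs.
have [m me] : exists m, m.+1%:R^-1 < e / 2 :> R.
  have e20 : 0 < e / 2 by rewrite divr_gt0.
  exists (Num.truncn (e / 2)^-1); rewrite invf_plt ?posrE//.
  by rewrite truncnS_gt.
have [q [yq Dq]] : ball y (m.+1%:R^-1) `&` D !=set0.
  apply: dD; last by exact: ball_open.
  by exists y; apply: ballxx; rewrite invr_gt0.
have [n _ gn] := gD q Dq.
have BU : B n m `<=` U.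
  move=> z; rewrite /B gn => qz; apply: yU.
  apply: (@le_ball _ _ _ (e / 2 + e / 2)).
    by rewrite -splitr.
  by apply: ball_triangle; apply: (le_ball (ltW me)); [exact: yq|exact: qz].
exists (pickle (n, m)) => //; rewrite /F pickleK ifT.
  by rewrite /B gn; exact: ball_sym.
apply: le_lt_trans muU; apply: le_measure; rewrite ?inE//.
exact: open_borel.
Qed.

End Borel.

(** * Balls and the regularity constant *)

Section Balls.
Context {R : realType} {H : completeNormedModType R}.
Implicit Types (x : H) (t : R).

Lemma closed_ballP x t : 0 < t ->
  forall y, closed_ball x t y <-> `|x - y| <= t.
Proof. by move=> t0 y; rewrite closed_ballE. Qed.

Lemma diam_closed_ball d x t : dim_gt d H -> 0 < t ->
  0 < diam (closed_ball x t) <= t + t.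
Proof.
move=> [w wfree] t0.
have w0 : w ord0 != 0.
  apply/eqP => w0; have := wfree (fun i => (i == ord0)%:R).
  rewrite big1 => [|i _]; last first.
    by case: eqVneq => [->|]; rewrite ?w0 ?scaler0// scale0r.
  by move=> /(_ erefl ord0) /eqP; rewrite eqxx oner_eq0.
(* [x] and [y] are at distance [t], so the ball has positive diameter. *)
pose y := x + (t / `|w ord0|) *: w ord0.
have xyE : `|x - y| = t.
  rewrite /y opprD addrA subrr add0r normrN normrZ normrM normfV normr_id.
  by rewrite mulfVK ?normr_eq0// gtr0_norm.
have Bt z : closed_ball x t z -> `|x - z| <= t by move/(closed_ballP _ t0).
have Bx : closed_ball x t x by apply/closed_ballP; rewrite ?subrr ?normr0// ltW.
have By : closed_ball x t y by apply/closed_ballP; rewrite ?xyE.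
rewrite (diam_le Bt Bx By) andbT (lt_le_trans t0)//.
by rewrite -[leLHS]xyE (le_diam Bt Bx By).
Qed.

(** Every regularity bound controls the measure of this one ball, hence so does
    their infimum [regularity_constant d mu]. *)
Lemma measure_closed_ball d (mu : {measure set (borel H) -> \bar R}) x t :
  regular d mu -> supp mu x -> 0 < t -> (t%:E <= ediam (supp mu))%E ->
  exists b : R, [/\ mu (closed_ball x t) = b%:E, 0 < b
    & b <= regularity_constant d mu * t ^+ d].
Proof.
move=> [_ [C1 bC1]] sx t0 td.
have [C11 /(_ x t sx t0 td) /andP[lo hi]] := bC1.
have fin : mu (closed_ball x t) \is a fin_num.
  rewrite fin_numE; apply/andP; split.
    by apply: contraTneq lo => ->.
  by apply: contraTneq hi => ->.
have td0 : 0 < t ^+ d by exact: exprn_gt0.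
exists (fine (mu (closed_ball x t))); split; first by rewrite fineK.
  rewrite -lte_fin fineK//; apply: lt_le_trans lo.
  by rewrite lte_fin mulr_gt0// invr_gt0 (lt_le_trans ltr01).
rewrite -ler_pdivrMr//; apply: lb_le_inf; first by exists C1.
move=> C [_ /(_ x t sx t0 td) /andP[_ ]].
by rewrite -{1}(fineK fin) lee_fin ler_pdivrMr.
Qed.

Lemma regularity_constant_ge1 d (mu : {measure set (borel H) -> \bar R}) :
  regular d mu -> 1 <= regularity_constant d mu.
Proof. by move=> [_ C0]; apply: lb_le_inf => // C []. Qed.

End Balls.

(** * The integral of the curvature over separated simplices *)

Section CurvatureIntegral.
Context {R : realType} {H : completeNormedModType R} (ip : {dot H for idfun}).
Hypothesis ipE : is_hilbert ip.
Variables (d : nat) (mu : {measure set (borel H) -> \bar R}).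
Hypotheses (smu : sigma_finite setT mu) (Hdim : dim_gt d H).

(** One factor [d.+2] comes from the pointwise bound and the other from the sum
    over the vertices, which all contribute the same integral. *)
Lemma integral_curvature_sq_le (x : H) (t lambda b : R) (L : set H) :
  0 < t -> 0 < lambda -> mu (closed_ball x t) = b%:E -> is_plane d L ->
  (\int[power_measure mu d.+2]_(v in separated_simplices d lambda x t)
     (curvature_sq ip v)%:E
   <= (d.+1`!%:R * d.+1%:R ^+ 2 * d.+2%:R / (lambda * t) ^+ (d * d.+1 + 2)
       * d.+2%:R * b ^+ d.+1)%:E
      * \int[mu]_(y in closed_ball x t) (dist y L ^+ 2)%:E)%E.
Proof.
move=> t0 l0 mub pL; have L0 := plane_neq0 pL.
set K := _ * d.+2%:R / _; set B := closed_ball x t.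
have K0 : 0 <= K by rewrite divr_ge0 ?mulr_ge0 ?exprn_ge0 ?mulr_ge0// ltW.
have mB : measurable (B : set (borel H)).
  by apply: closed_borel; exact: closed_ball_closed.
pose f (y : borel H) : \bar R := (dist y L ^+ 2)%:E.
have f0 y : (0 <= f y)%E by rewrite lee_fin sqr_ge0.
have mf : measurable_fun setT f.
  apply/measurable_EFinP; apply: measurable_funX.
  exact: continuous_borel (continuous_dist L0).
have [m mE] := power_measure_is_measure d.+2 smu.
pose box := [set v : d.+2.-tuple (borel H) | forall i, B (tnth v i)].
have mbox : measurable box by exact: (@measurable_box _ (borel H) d.+2 (fun=> B)).
have mfi i : measurable_fun setT (fun v : d.+2.-tuple (borel H) => f (tnth v i)).
  exact: measurableT_comp (measurable_tnth i).
rewrite mE; apply: (@le_trans _ _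
    (\int[m]_(v in box) (K%:E * \sum_(i < d.+2) f (tnth v i)))%E).
  apply: le_integral_majorant.
  - by move=> v [].
  - move=> v [vB sep]; apply/andP; split; last first.
      rewrite sumEFin -EFinM lee_fin.
      apply: (@curvature_sq_le _ _ _ ipE _ _ _ x t) => //.
      + by rewrite mulr_gt0.
      + by move=> i; apply/closed_ballP.
    rewrite lee_fin; apply: mulr_ge0; last first.
      by apply: sumr_ge0 => i _; rewrite invr_ge0 prodr_ge0.
    rewrite mulr_ge0// divr_ge0 ?sqr_ge0// exprn_ge0//.
    apply: le_trans (le_diam (A := range (tnth v)) (x := x) (t := t)
      (p := tnth v ord0) (q := tnth v ord0) _ _ _) => //.
    by move=> _ [i _ <-]; apply/closed_ballP.
  - by move=> v _; rewrite mule_ge0// sume_ge0.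
rewrite ge0_integralZl//; last 2 first.
- by apply: measurable_funTS; exact: emeasurable_sum.
- by move=> v _; rewrite sume_ge0.
rewrite ge0_integral_sum//; last first.
  by move=> i; apply: measurable_funTS.
rewrite -mE (eq_bigr (fun=> 1%:E * ((b ^+ d.+1)%:E * \int[mu]_(y in B) f y)))%E.
  by rewrite -ge0_sume_distrl// sumEFin sumr_const card_ord !muleA -!EFinM.
by move=> i _; rewrite mul1e; exact: integral_tnth_box.
Qed.

(** The constant 16 is the product of two factors 4: one from the square of the
    diameter of the ball, the other from [lambda ^+ 2 <= 4]. *)
Lemma integral_curvature_sq_le_flatness (x : H) (t lambda b C : R) (L : set H) :
  0 < t -> 0 < lambda -> mu (closed_ball x t) = b%:E -> 0 < b ->
  b <= C * t ^+ d -> is_plane d L ->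
  (\int[power_measure mu d.+2]_(v in separated_simplices d lambda x t)
     (curvature_sq ip v)%:E
   <= (16 * d.+1`!%:R * d.+1%:R ^+ 2 * d.+2%:R ^+ 2 * C ^+ d.+1
       / lambda ^+ (d * d.+1 + 4))%:E
      * \int[mu]_(y in closed_ball x t)
          ((dist y L / diam (closed_ball x t)) ^+ 2)%:E)%E.
Proof.
move=> t0 l0 mub b0 bC pL; set B := closed_ball x t; set D := diam B.
have [D0 D2t] := andP (diam_closed_ball x Hdim t0).
have C0 : 0 < C by rewrite -(pmulr_lgt0 _ (exprn_gt0 d t0)) (lt_le_trans b0).
set J := (X in (_ <= _ * X)%E).
have J0 : (0 <= J)%E by apply: integral_ge0 => y _; rewrite lee_fin sqr_ge0.
set P := (X in (_ <= X%:E * _)%E).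
have P0 : 0 <= P.
  by rewrite divr_ge0 ?exprn_ge0 ?mulr_ge0 ?exprn_ge0// ltW.
(* Two points of the ball are at distance at most [2 t], so there is no
   [lambda]-separated simplex in it when [2 < lambda]. *)
have [l2|l2] := leP lambda 2; last first.
  rewrite (_ : separated_simplices _ _ _ _ = set0).
    have [m ->] := power_measure_is_measure d.+2 smu.
    by rewrite integral_set0 mule_ge0.
  apply/seteqP; split => // v [vB sep]; have := sep ord0 ord_max isT.
  apply/negP; rewrite -ltNge (@le_lt_trans _ _ (t + t))//; last first.
    by rewrite -mulr2n -mulr_natl ltr_pM2r.
  rewrite -(subrK x (tnth v ord0)) -addrA (le_trans (ler_normD _ _))// lerD//.
    by rewrite distrC; apply/closed_ballP.
  by apply/closed_ballP.
apply: le_trans (integral_curvature_sq_le t0 l0 mub pL) _.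
have L0 := plane_neq0 pL.
have mB : measurable (B : set (borel H)).
  by apply: closed_borel; exact: closed_ball_closed.
have -> : (\int[mu]_(y in B) (dist y L ^+ 2)%:E = (D ^+ 2)%:E * J)%E.
  rewrite -ge0_integralZl//; last 3 first.
  - apply/measurable_EFinP/measurable_funX/measurable_funM => //.
    by apply: measurable_funTS; exact: continuous_borel (continuous_dist L0).
  - by move=> y _; rewrite lee_fin sqr_ge0.
  - by rewrite lee_fin sqr_ge0.
  apply: eq_integral => y _; rewrite -EFinM; congr EFin.
  by rewrite -exprMn mulrC mulfVK// gt_eqF.
rewrite muleA -EFinM lee_wpmul2r// lee_fin.
have bm : b ^+ d.+1 <= C ^+ d.+1 * t ^+ (d * d.+1).
  by rewrite exprM -exprMn lerXn2r ?nnegrE// ltW// (lt_le_trans b0).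
have D2 : D ^+ 2 <= 4 * t ^+ 2.
  rewrite (_ : 4 * t ^+ 2 = (t + t) ^+ 2); last by ring.
  by rewrite lerXn2r ?nnegrE ?addr_ge0// ltW.
(* This factor trades [lambda ^- 2] for [lambda ^- 4]. *)
have l4 : 1 <= 4 / lambda ^+ 2.
  rewrite ler_pdivlMr ?exprn_gt0// mul1r (_ : 4 = 2 ^+ 2); last by ring.
  by rewrite lerXn2r ?nnegrE// ltW.
set K := d.+1`!%:R * d.+1%:R ^+ 2 * d.+2%:R.
set K' := K / (lambda * t) ^+ (d * d.+1 + 2) * d.+2%:R.
have K'0 : 0 <= K' by rewrite !mulr_ge0 ?invr_ge0 ?exprn_ge0 ?mulr_ge0// ltW.
apply: (@le_trans _ _ (K' * (C ^+ d.+1 * t ^+ (d * d.+1)) * (4 * t ^+ 2)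
    * (4 / lambda ^+ 2))).
  have bm0 : 0 <= K' * b ^+ d.+1 by rewrite mulr_ge0// exprn_ge0// ltW.
  rewrite -[leLHS]mulr1; apply: ler_pM => //; first by rewrite mulr_ge0 ?sqr_ge0.
  apply: ler_pM => //; first exact: sqr_ge0.
  exact: ler_wpM2l.
rewrite le_eqVlt; apply/orP; left; apply/eqP.
rewrite /P /K' /K (_ : (d * d.+1 + 4 = d * d.+1 + 2 + 2)%N); last first.
  by rewrite -addnA.
rewrite exprMn [lambda ^+ (_ + 2 + 2)]exprD (exprD t).
by field; rewrite !expf_neq0 ?gt_eqF.
Qed.

End CurvatureIntegral.

Theorem proposition1p1 (R : realType) (d : nat) :
  exists C0 : R -> R,
    forall (H : completeNormedModType R) (ip : {dot H for idfun})
      (mu : {measure set (borel H) -> \bar R}),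
      is_hilbert ip -> separable H -> dim_gt d H -> regular d mu ->
      1 <= C0 (regularity_constant d mu) /\
      forall (lambda : R) (x : H) (t : R),
        0 < lambda -> supp mu x -> 0 < t -> (t%:E <= ediam (supp mu))%E ->
        (\int[power_measure mu d.+2]_(v in separated_simplices d lambda x t)
            (curvature_sq ip v)%:E
         <= (C0 (regularity_constant d mu) / lambda ^+ (d * d.+1 + 4))%:E
            * beta2_sq d mu x t * mu (closed_ball x t))%E.
Proof.
exists (fun C => 16 * d.+1`!%:R * d.+1%:R ^+ 2 * d.+2%:R ^+ 2 * C ^+ d.+1).
move=> H ip mu ipE Hsep Hdim Hreg.
have C1 := regularity_constant_ge1 Hreg; set C := regularity_constant d mu.
have K1 : (1 : R) <= 16 * d.+1`!%:R * d.+1%:R ^+ 2 * d.+2%:R ^+ 2.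
  by rewrite -!natrX -!natrM ler1n !muln_gt0 fact_gt0.
have C01 : 1 <= 16 * d.+1`!%:R * d.+1%:R ^+ 2 * d.+2%:R ^+ 2 * C ^+ d.+1.
  by rewrite mulr_ege1// exprn_ege1.
split=> // lambda x t l0 sx t0 td.
have [b [mub b0 bC]] := measure_closed_ball Hreg sx t0 td.
have smu := sigma_finite_locally_finite Hsep Hreg.1.
set P := _ / lambda ^+ _.
have P0 : 0 < P by rewrite divr_gt0 ?exprn_gt0// (lt_le_trans ltr01).
have Pb0 : 0 < P * b by exact: mulr_gt0.
set X := (X in (X <= _)%E).
rewrite mub muleAC -EFinM -lee_pdivrMl//.
apply: le_ereal_inf_tmp => _ [L pL <-].
(* The factor [mu B] cancels the averaging in the definition of beta. *)
rewrite mub inver gt_eqF// lee_pdivrMl//.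
rewrite [X in (_ <= _ * X)%E]muleC muleA -EFinM mulfK ?gt_eqF//.
exact (integral_curvature_sq_le_flatness ipE smu Hdim t0 l0 mub b0 bC pL).
Qed.
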